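(* Let $R$ be a ring with local units and let $\alpha:R\to R$ be a ring automorphism. Then the following two statements are equivalent: (1) The crossed product $R\times_\alpha\mathbb{Z}$ is simple. (2) The automorphism $\alpha$ is outer and the only strongly $\alpha$-invariant ideals in $R$ are $\{0\}$ and $R$.
   Context: Rings are associative and not necessarily unital. ''Ideal'' means two-sided ideal; a ring is simple if it is non-zero and has no ideals other than $\{0\}$ and itself. $\mathbb{N}=\{1,2,\dots\}$. $R$ has local units if for every finite set $F\subseteq R$ there is an idempotent $e\in R$ with $er=re=r$ for all $r\in F$. The crossed product $R\times_\alpha\mathbb{Z}$ (skew group ring) is the ring of finite formal sums $\sum_{n\in\mathbb{Z}}r_n\delta_n$ with $r_n\in R$, with componentwise addition and multiplication determined by $(r\delta_n)(s\delta_m)=r\alpha^n(s)\delta_{n+m}$. Multiplier ring: a double centralizer on $R$ is a pair $(f,g)$ where $f:R\to R$ is a right $R$-module homomorphism, $g:R\to R$ is a left $R$-module homomorphism, and $r_1f(r_2)=g(r_1)r_2$ for all $r_1,r_2\in R$. $\mathcal{M}(R)$ is the ring of all double centralizers with $(f_1,g_1)+(f_2,g_2)=(f_1+f_2,g_1+g_2)$ and $(f_1,g_1)(f_2,g_2)=(f_1\circ f_2,g_2\circ g_1)$; its unit is $1=(\mathrm{Id}_R,\mathrm{Id}_R)$. $R$ embeds as an ideal of $\mathcal{M}(R)$ via $r\mapsto(s\mapsto rs,\,s\mapsto sr)$, and for $u=(f,g)\in\mathcal{M}(R)$, $r\in R$ one has $ur=f(r)$, $ru=g(r)$. For $n\in\mathbb{N}$,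 $\alpha$ is inner with periodicity $n$ if there are $u,v\in\mathcal{M}(R)$ with $vu=1$, and $\alpha^n(r)=urv$ and $\alpha(ur)=u\alpha(r)$ for all $r\in R$. $\alpha$ is outer if it is not inner with periodicity $n$ for any $n\in\mathbb{N}$. An ideal $I$ of $R$ is strongly $\alpha$-invariant if $\alpha(I)\subseteq I$ and $\alpha(R)I\alpha(R)\subseteq\alpha(I)$. *)

(* Defs.v *)
From HB Require Import structures.
From mathcomp Require Import all_boot all_order all_algebra finmap.
From mathcomp Require Import boolp classical_sets.
From mathcomp.multinomials Require Import monalg.

Set Implicit Arguments.
Unset Strict Implicit.
Unset Printing Implicit Defensive.

Import GRing.Theory.
Local Open Scope classical_set_scope.
Local Open Scope ring_scope.

(* Associative, not necessarily unital rings.  Addition is in ring_scope, while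
   the product is that of semigroupType, written in group_scope: (x * y)%g.   *)

HB.mixin Record Zmodule_Semigroup_isRng R
    of GRing.Zmodule R & Semigroup R := {
  rmulDl : left_distributive (@monoid.mul R) +%R;
  rmulDr : right_distributive (@monoid.mul R) +%R
}.

#[short(type="rngType")]
HB.structure Definition Rng :=
  {R of GRing.Zmodule R & Semigroup R & Zmodule_Semigroup_isRng R}.

Section RngTheory.
Variable R : rngType.
Implicit Types x y : R.

Lemma rmul0l x : (0 * x)%g = 0 :> R.
Proof. by apply: (addrI (0 * x)%g); rewrite -rmulDl !addr0. Qed.

Lemma rmul0r x : (x * 0)%g = 0 :> R.
Proof. by apply: (addrI (x * 0)%g); rewrite -rmulDr !addr0. Qed.

Lemma rmulNl x y : (- x * y)%g = - (x * y)%g.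
Proof. by apply: (addrI (x * y)%g); rewrite -rmulDl !subrr rmul0l. Qed.

Lemma rmulNr x y : (x * - y)%g = - (x * y)%g.
Proof. by apply: (addrI (x * y)%g); rewrite -rmulDr !subrr rmul0r. Qed.

End RngTheory.

Definition is_ideal (R : rngType) (I : set R) : Prop :=
  [/\ I 0, forall x y, I x -> I y -> I (x - y)
    & forall r x, I x -> I (r * x)%g /\ I (x * r)%g].

Definition simple_rng (R : rngType) : Prop :=
  (exists x : R, x != 0) /\
  (forall I : set R, is_ideal I -> I = [set 0] \/ I = setT).

Definition has_local_units (R : rngType) : Prop :=
  forall F : {fset R}, exists e : R, (e * e)%g = e /\
    forall r, r \in F -> (e * r)%g = r /\ (r * e)%g = r.

Record rng_aut (R : rngType) := RngAut {
  rng_aut_fun :> R -> R;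
  rng_autB : zmod_morphism rng_aut_fun;
  rng_autM : {morph rng_aut_fun : x y / (x * y)%g};
  rng_aut_bij : bijective rng_aut_fun
}.

HB.instance Definition _ (R : rngType) (alpha : rng_aut R) :=
  GRing.isZmodMorphism.Build R R (rng_aut_fun alpha) (rng_autB alpha).
HB.instance Definition _ (R : rngType) (alpha : rng_aut R) :=
  monoid.isMultiplicative.Build R R (rng_aut_fun alpha) (rng_autM alpha).

Section RngAutTheory.
Variables (R : rngType) (alpha : rng_aut R).

Fact rng_aut_surj y : exists x, alpha x == y.
Proof. by case: (rng_aut_bij alpha) => g _ gK; exists (g y); rewrite gK. Qed.

Definition rng_aut_inv y : R := xchoose (rng_aut_surj y).

Lemma rng_aut_invK : cancel rng_aut_inv alpha.
Proof. by move=> y; apply/eqP/(xchooseP (rng_aut_surj y)). Qed.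

Lemma rng_autK : cancel alpha rng_aut_inv.
Proof. by move=> x; apply: (bij_inj (rng_aut_bij alpha)); exact: rng_aut_invK. Qed.

Definition aut_zpow (n : int) : R -> R :=
  match n with
  | Posz k => iter k alpha
  | Negz k => iter k.+1 rng_aut_inv
  end.

Lemma aut_zpowS (n : int) x : aut_zpow (n + 1) x = alpha (aut_zpow n x).
Proof.
case: n => [n|[|n]]; first by rewrite -PoszD addn1.
  by rewrite /= rng_aut_invK.
have -> : Negz n.+1 + 1 = Negz n by rewrite !NegzE -(addn1 n.+1) PoszD opprD addrNK.
by rewrite [in RHS]/= rng_aut_invK.
Qed.

Lemma aut_zpowD (m n : int) x : aut_zpow (m + n) x = aut_zpow m (aut_zpow n x).
Proof.
elim/int_rect: m x => [|k IH|k IH] x; first by rewrite add0r.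
  by rewrite -addn1 PoszD addrAC !aut_zpowS IH.
apply: (bij_inj (rng_aut_bij alpha)).
have e1 : - (k.+1 : int) + 1 = - k%:Z.
  by rewrite -addn1 PoszD opprD addrNK.
by rewrite -!aut_zpowS addrAC e1 IH.
Qed.

Lemma rng_aut_inv_is_additive : zmod_morphism rng_aut_inv.
Proof.
by move=> x y; apply: (canLR rng_autK); rewrite raddfB /= !rng_aut_invK.
Qed.

Lemma rng_aut_invM : {morph rng_aut_inv : x y / (x * y)%g}.
Proof.
by move=> x y; apply: (canLR rng_autK); rewrite rng_autM !rng_aut_invK.
Qed.

Lemma aut_zpowB n : zmod_morphism (aut_zpow n).
Proof.
case: n => n x y; last first.
  by rewrite /=; elim: n => [|n IH] /=; rewrite ?IH rng_aut_inv_is_additive.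
by rewrite /=; elim: n => [|n IH] //=; rewrite IH raddfB.
Qed.

HB.instance Definition _ n :=
  GRing.isZmodMorphism.Build R R (aut_zpow n) (aut_zpowB n).

Lemma aut_zpowM n : {morph aut_zpow n : x y / (x * y)%g}.
Proof.
case: n => n x y; last first.
  by rewrite /=; elim: n => [|n IH] /=; rewrite ?IH rng_aut_invM.
by rewrite /=; elim: n => [|n IH] //=; rewrite IH rng_autM.
Qed.

End RngAutTheory.

(* The crossed product: {malg R[int]} is the additive group of finitely
   supported maps int -> R, and << r *g n >> stands for r delta_n.            *)

Definition crossed (R : rngType) (alpha : rng_aut R) : Type := {malg R[int]}.

HB.instance Definition _ (R : rngType) (alpha : rng_aut R) :=
  GRing.Zmodule.on (crossed alpha).

Section Crossed.
Variables (R : rngType) (alpha : rng_aut R).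
Implicit Types a b c : {malg R[int]}.

Definition crossed_mul a b : {malg R[int]} :=
  \sum_(n <- msupp a) \sum_(m <- msupp b)
    << (a@_n * aut_zpow alpha n b@_m)%g *g (n + m)%R >>.

Lemma crossed_mulw (d1 d2 : {fset int}) a b :
  (msupp a `<=` d1)%fset -> (msupp b `<=` d2)%fset ->
  crossed_mul a b = \sum_(n <- d1) \sum_(m <- d2)
    << (a@_n * aut_zpow alpha n b@_m)%g *g (n + m)%R >>.
Proof.
move=> le1 le2; rewrite /crossed_mul (big_fset_incl _ le1) /=.
  apply/eq_bigr=> n _; apply/big_fset_incl => // m _ /mcoeff_outdom ->.
  by rewrite raddf0 rmul0r monalgU0.
move=> n _ /mcoeff_outdom an.
by rewrite big1 // => m _; rewrite an rmul0l monalgU0.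
Qed.

Lemma crossed_mulUU r s n m :
  crossed_mul << r *g n >> << s *g m >>
  = << (r * aut_zpow alpha n s)%g *g (n + m)%R >>.
Proof. by rewrite (crossed_mulw msuppU_le msuppU_le) !big_seq_fset1 !mcoeffUU. Qed.

Lemma crossed_mulDl : left_distributive crossed_mul +%R.
Proof.
move=> a b c.
rewrite (crossed_mulw (msuppD_le a b) (fsubset_refl _)).
rewrite (crossed_mulw (fsubsetUl (msupp a) (msupp b)) (fsubset_refl _)).
rewrite (crossed_mulw (fsubsetUr (msupp a) (msupp b)) (fsubset_refl _)).
rewrite -big_split /=; apply/eq_bigr=> n _.
rewrite -big_split /=; apply/eq_bigr=> m _.
by rewrite mcoeffD rmulDl monalgUD.
Qed.

Lemma crossed_mulDr : right_distributive crossed_mul +%R.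
Proof.
move=> c a b.
rewrite (crossed_mulw (fsubset_refl _) (msuppD_le a b)).
rewrite (crossed_mulw (fsubset_refl _) (fsubsetUl (msupp a) (msupp b))).
rewrite (crossed_mulw (fsubset_refl _) (fsubsetUr (msupp a) (msupp b))).
rewrite -big_split /=; apply/eq_bigr=> n _.
rewrite -big_split /=; apply/eq_bigr=> m _.
by rewrite mcoeffD raddfD rmulDr monalgUD.
Qed.

Lemma crossed_mul0l a : crossed_mul 0 a = 0.
Proof. by apply: (addrI (crossed_mul 0 a)); rewrite -crossed_mulDl !addr0. Qed.

Lemma crossed_mul0r a : crossed_mul a 0 = 0.
Proof. by apply: (addrI (crossed_mul a 0)); rewrite -crossed_mulDr !addr0. Qed.

Lemma crossed_mul_suml (s : seq int) (F : int -> {malg R[int]}) b :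
  crossed_mul (\sum_(i <- s) F i) b = \sum_(i <- s) crossed_mul (F i) b.
Proof.
exact: (big_morph (crossed_mul^~ b) (fun _ _ => crossed_mulDl _ _ _)
  (crossed_mul0l b)).
Qed.

Lemma crossed_mul_sumr (s : seq int) (F : int -> {malg R[int]}) b :
  crossed_mul b (\sum_(i <- s) F i) = \sum_(i <- s) crossed_mul b (F i).
Proof.
exact: (big_morph (crossed_mul b) (fun _ _ => crossed_mulDr _ _ _)
  (crossed_mul0r b)).
Qed.

Lemma crossed_mulEl a b :
  crossed_mul a b = \sum_(n <- msupp a) crossed_mul << a@_n *g n >> b.
Proof. by rewrite {1}(monalgE a) [LHS]crossed_mul_suml. Qed.

Lemma crossed_mulEr a b :
  crossed_mul a b = \sum_(n <- msupp b) crossed_mul a << b@_n *g n >>.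
Proof. by rewrite {1}(monalgE b) [LHS]crossed_mul_sumr. Qed.

Lemma crossed_mulA : associative crossed_mul.
Proof.
move=> a b c; rewrite (crossed_mulEl a b) [RHS]crossed_mul_suml.
rewrite [LHS]crossed_mulEl; apply: eq_bigr => n _.
rewrite (crossed_mulEl b c) [LHS]crossed_mul_sumr.
rewrite (crossed_mulEr _ b) [RHS]crossed_mul_suml; apply: eq_bigr => m _.
rewrite (crossed_mulEr _ c) [LHS]crossed_mul_sumr [RHS]crossed_mulEr.
apply: eq_bigr => k _.
by rewrite !crossed_mulUU aut_zpowM aut_zpowD mulgA addrA.
Qed.

HB.instance Definition _ :=
  isSemigroup.Build (crossed alpha) crossed_mulA.
HB.instance Definition _ :=
  Zmodule_Semigroup_isRng.Build (crossed alpha) crossed_mulDl crossed_mulDr.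

End Crossed.

(* The multiplier ring: the double centralizer (f, g) is viewed as a multiplier
   u acting on R by u r = f r (lmult) and r u = g r (rmult).                  *)

Record multiplier (R : rngType) := Multiplier {
  lmult : R -> R;
  rmult : R -> R;
  lmultB : zmod_morphism lmult;
  rmultB : zmod_morphism rmult;
  lmultM : forall r s, lmult (r * s)%g = (lmult r * s)%g;
  rmultM : forall r s, rmult (r * s)%g = (r * rmult s)%g;
  multE : forall r s, (r * lmult s)%g = (rmult r * s)%g
}.

HB.instance Definition _ (R : rngType) := gen_eqMixin (multiplier R).
HB.instance Definition _ (R : rngType) := gen_choiceMixin (multiplier R).

Section Multiplier.
Variable R : rngType.
Implicit Types u v w : multiplier R.

HB.instance Definition _ u :=
  GRing.isZmodMorphism.Build R R (lmult u) (@lmultB R u).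
HB.instance Definition _ u :=
  GRing.isZmodMorphism.Build R R (rmult u) (@rmultB R u).

Lemma multP u v : lmult u =1 lmult v -> rmult u =1 rmult v -> u = v.
Proof.
case: u v => f1 g1 a1 b1 c1 d1 e1 [f2 g2 a2 b2 c2 d2 e2] /= /funext ef /funext eg.
by subst f2 g2; congr Multiplier; apply: Prop_irrelevance.
Qed.

Program Definition mult_zero : multiplier R :=
  @Multiplier R (fun=> 0) (fun=> 0) _ _ _ _ _.
Next Obligation. by move=> x y; rewrite subr0. Qed.
Next Obligation. by move=> x y; rewrite subr0. Qed.
Next Obligation. by rewrite rmul0l. Qed.
Next Obligation. by rewrite rmul0r. Qed.
Next Obligation. by rewrite rmul0l rmul0r. Qed.

Program Definition mult_opp u : multiplier R :=
  @Multiplier R (fun r => - lmult u r) (fun r => - rmult u r) _ _ _ _ _.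
Next Obligation. by move=> x y; rewrite raddfB opprD. Qed.
Next Obligation. by move=> x y; rewrite raddfB opprD. Qed.
Next Obligation. by rewrite lmultM rmulNl. Qed.
Next Obligation. by rewrite rmultM rmulNr. Qed.
Next Obligation. by rewrite rmulNl rmulNr multE. Qed.

Program Definition mult_add u v : multiplier R :=
  @Multiplier R (fun r => lmult u r + lmult v r)
    (fun r => rmult u r + rmult v r) _ _ _ _ _.
Next Obligation. by move=> x y; rewrite !raddfB opprD addrACA. Qed.
Next Obligation. by move=> x y; rewrite !raddfB opprD addrACA. Qed.
Next Obligation. by rewrite !lmultM rmulDl. Qed.
Next Obligation. by rewrite !rmultM rmulDr. Qed.
Next Obligation. by rewrite rmulDl rmulDr !multE. Qed.

Program Definition mult_one : multiplier R := @Multiplier R id id _ _ _ _ _.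
Next Obligation. by []. Qed.
Next Obligation. by []. Qed.

Program Definition mult_mul u v : multiplier R :=
  @Multiplier R (lmult u \o lmult v) (rmult v \o rmult u) _ _ _ _ _.
Next Obligation. by move=> x y; rewrite /= !raddfB. Qed.
Next Obligation. by move=> x y; rewrite /= !raddfB. Qed.
Next Obligation. by rewrite !lmultM. Qed.
Next Obligation. by rewrite !rmultM. Qed.
Next Obligation. by rewrite !multE. Qed.

Fact mult_addA : associative mult_add.
Proof. by move=> u v w; apply: multP => r /=; rewrite addrA. Qed.
Fact mult_addC : commutative mult_add.
Proof. by move=> u v; apply: multP => r /=; rewrite addrC. Qed.
Fact mult_add0 : left_id mult_zero mult_add.
Proof. by move=> u; apply: multP => r /=; rewrite add0r. Qed.
Fact mult_addN : left_inverse mult_zero mult_opp mult_add.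
Proof. by move=> u; apply: multP => r /=; rewrite addNr. Qed.

HB.instance Definition _ := GRing.isZmodule.Build (multiplier R)
  mult_addA mult_addC mult_add0 mult_addN.

Fact mult_mulA : associative mult_mul.
Proof. by move=> u v w; apply: multP. Qed.
Fact mult_mul1l : left_id mult_one mult_mul.
Proof. by move=> u; apply: multP. Qed.
Fact mult_mul1r : right_id mult_one mult_mul.
Proof. by move=> u; apply: multP. Qed.
Fact mult_mulDl : left_distributive mult_mul +%R.
Proof. by move=> u v w; apply: multP => r //=; rewrite raddfD. Qed.
Fact mult_mulDr : right_distributive mult_mul +%R.
Proof. by move=> u v w; apply: multP => r //=; rewrite raddfD. Qed.

HB.instance Definition _ := GRing.Zmodule_isPzRing.Build (multiplier R)
  mult_mulA mult_mul1l mult_mul1r mult_mulDl mult_mulDr.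

(* The canonical map R -> M(R), for which u r and r u are products in M(R). *)
Program Definition mult_of (r : R) : multiplier R :=
  @Multiplier R (fun s => (r * s)%g) (fun s => (s * r)%g) _ _ _ _ _.
Next Obligation. by move=> x y; rewrite rmulDr rmulNr. Qed.
Next Obligation. by move=> x y; rewrite rmulDl rmulNl. Qed.
Next Obligation. by rewrite mulgA. Qed.
Next Obligation. by rewrite mulgA. Qed.
Next Obligation. by rewrite mulgA. Qed.

Lemma mult_of_lmult u r : mult_of (lmult u r) = u * mult_of r.
Proof. by apply: multP => s /=; rewrite ?lmultM ?multE. Qed.

Lemma mult_of_rmult u r : mult_of (rmult u r) = mult_of r * u.
Proof. by apply: multP => s /=; rewrite ?rmultM ?multE. Qed.

Lemma mult_of_inj : has_local_units R -> injective mult_of.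
Proof.
move=> lu r s /(congr1 (@lmult R)) /= /funeqP ers.
have [e [_ he]] := lu [fset r; s]%fset.
have [_ <-] := he r (fset21 _ _); have [_ <-] := he s (fset22 _ _).
exact: ers.
Qed.

End Multiplier.

Section Outer.
Variables (R : rngType) (alpha : rng_aut R).

(* u r v is read as (u r) v. *)
Definition inner_with_periodicity (n : nat) : Prop :=
  exists u v : multiplier R,
    [/\ v * u = 1,
        forall r : R, iter n alpha r = rmult v (lmult u r)
      & forall r : R, alpha (lmult u r) = lmult u (alpha r)].

Definition is_outer : Prop :=
  forall n : nat, (0 < n)%N -> ~ inner_with_periodicity n.

(* alpha(R) I alpha(R) is the set of finite sums of products a x b. *)
Definition triple_product (A B C : set R) : set R :=
  [set y | exists s : seq (R * R * R),
     (forall t, t \in s -> [/\ A t.1.1, B t.1.2 & C t.2]) /\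
     y = \sum_(t <- s) (t.1.1 * t.1.2 * t.2)%g].

Definition strongly_invariant (I : set R) : Prop :=
  alpha @` I `<=` I /\
  triple_product (alpha @` setT) I (alpha @` setT) `<=` alpha @` I.

End Outer.

(* Main.v *)
Require Import Defs.
From mathcomp Require Import all_boot all_order all_algebra.
From mathcomp Require Import boolp classical_sets.
From mathcomp Require Import finmap.
From mathcomp.multinomials Require Import monalg.

Local Open Scope classical_set_scope.
Local Open Scope ring_scope.

Import Order.TTheory GRing.Theory Num.Theory.

(** Since alpha is onto and R has local units, the strongly invariant ideals are
    the ideals I with alpha(I) = I ([strongly_invariantP]).

    Suppose that the crossed product is simple.  An ideal I with alpha(I) = I
    yields the ideal of all elements with coefficients in I, so I is trivial
    ([simple_crossed_invariant]).  If alpha were inner with periodicity n,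
    through multipliers u and v, then z = u delta_(-n) would be a central
    multiplier of the crossed product, and 1 - z would generate an ideal that is
    neither zero nor everything ([outer_of_simple_crossed]).

    Conversely, let J be a non-zero ideal of the crossed product.  Shifting
    degrees, J contains a non-zero element supported in [0, N] for some N; take N
    least ([min_supported]).  Then an element of J supported in [0, N] is
    determined by its coefficient in degree 0, and also by its coefficient in
    degree N.  The sets of coefficients occurring at either end are non-zero
    ideals stable under alpha and its inverse, hence equal to R when there are no
    others.  Sending the coefficient in degree 0 to the one in degree N is then a
    bijection phi of R onto itself, left linear, commuting with alpha, and
    satisfying phi (r s) = phi r * alpha^N s.  Such a phi is right multiplication
    by an invertible multiplier that makes alpha inner with periodicity N
    ([inner_of_twisted_iso]), which is excluded if alpha is outer and N > 0.  So
    N = 0, J contains R delta_0, and therefore it is the whole crossed product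
    ([simple_crossed_of_outer]). *)

(** * Coefficients in the crossed product *)

Lemma rmul_suml (R : rngType) (s : seq int) (F : int -> R) (x : R) :
  ((\sum_(i <- s) F i) * x)%g = \sum_(i <- s) (F i * x)%g.
Proof.
exact: (big_morph (fun y => (y * x)%g) (fun _ _ => rmulDl _ _ _) (rmul0l x)).
Qed.

Lemma rmul_sumr (R : rngType) (s : seq int) (F : int -> R) (x : R) :
  (x * \sum_(i <- s) F i)%g = \sum_(i <- s) (x * F i)%g.
Proof.
exact: (big_morph (fun y => (x * y)%g) (fun _ _ => rmulDr _ _ _) (rmul0r x)).
Qed.

Lemma mcoeff_crossed_Umul (R : rngType) (alpha : rng_aut R)
    (r : R) (k m : int) (b : crossed alpha) :
  (((<< r *g k >> : crossed alpha) * b)%g : crossed alpha)@_m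
  = (r * aut_zpow alpha k b@_(m - k))%g.
Proof.
rewrite [(_ * b)%g]crossed_mulEr [in RHS](monalgE b) !raddf_sum rmul_sumr.
apply: eq_bigr => n _; rewrite /= crossed_mulUU !mcoeffU raddfMn.
rewrite (addrC k) eq_sym -subr_eq eq_sym.
by case: eqP; rewrite ?mulr0n ?rmul0r.
Qed.

Lemma mcoeff_crossed_mulU (R : rngType) (alpha : rng_aut R)
    (s : R) (k m : int) (a : crossed alpha) :
  ((a * (<< s *g k >> : crossed alpha))%g : crossed alpha)@_m
  = (a@_(m - k) * aut_zpow alpha (m - k) s)%g.
Proof.
rewrite [(a * _)%g]crossed_mulEl [in RHS](monalgE a) !raddf_sum rmul_suml.
apply: eq_bigr => n _; rewrite /= crossed_mulUU !mcoeffU eq_sym -subr_eq eq_sym.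
by case: eqP => [->|_]; rewrite ?mulr0n ?rmul0l.
Qed.

Lemma mcoeff_crossed_mull (R : rngType) (alpha : rng_aut R)
    (a b : crossed alpha) (m : int) :
  ((a * b)%g : crossed alpha)@_m
  = \sum_(n <- msupp a) (a@_n * aut_zpow alpha n b@_(m - n))%g.
Proof.
rewrite [(a * b)%g]crossed_mulEl raddf_sum.
by apply: eq_bigr => n _; exact: mcoeff_crossed_Umul.
Qed.

Lemma mcoeff_crossed_mulr (R : rngType) (alpha : rng_aut R)
    (a b : crossed alpha) (m : int) :
  ((a * b)%g : crossed alpha)@_m
  = \sum_(k <- msupp b) (a@_(m - k) * aut_zpow alpha (m - k) b@_k)%g.
Proof.
rewrite [(a * b)%g]crossed_mulEr raddf_sum.
by apply: eq_bigr => n _; exact: mcoeff_crossed_mulU.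
Qed.

(** * Smallest and largest degrees *)

Lemma seq_int_min (s : seq int) : s != [::] ->
  exists2 m, m \in s & forall k, k \in s -> m <= k.
Proof.
elim: s => // x [|y s] IH _.
  by exists x; rewrite ?mem_head // => k /[!inE] /eqP->.
have [m ms mP] := IH isT.
have [xm|mx] := leP x m; last first.
  by exists m => [|k]; rewrite inE ?ms ?orbT // => /predU1P[->|/mP//]; exact: ltW.
exists x => [|k]; rewrite inE ?eqxx // => /predU1P[->//|/mP]; exact: le_trans.
Qed.

Lemma msupp_extrema (R : rngType) (a : {malg R[int]}) : a != 0 ->
  exists m M : int, [/\ a@_m != 0, a@_M != 0 &
    forall k, a@_k != 0 -> m <= k <= M].
Proof.
move=> a0.
have s0 : (msupp a : seq int) != [::].
  apply: contraNneq a0 => s0; apply/eqP/malgP => k.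
  have ks : k \notin (msupp a : seq int) by rewrite s0.
  by rewrite mcoeff0; exact: mcoeff_outdom ks.
have [m ms mP] := seq_int_min _ s0.
have [|M' + MP] := seq_int_min (map -%R (msupp a)).
  by rewrite -size_eq0 size_map size_eq0.
case/mapP => M Ms eM; exists m, M; rewrite !mcoeff_neq0 ms Ms; split=> // k.
rewrite mcoeff_neq0 => ks; rewrite mP //=.
by have := MP (- k) (map_f _ ks); rewrite eM lerN2.
Qed.

(** * Ideals and invariance *)

Lemma ideal_add (R : rngType) (I : set R) (x y : R) :
  is_ideal I -> I x -> I y -> I (x + y).
Proof.
move=> [I0 IB _] Ix Iy; rewrite -[y]opprK -[- y]sub0r.
by apply: (IB) => //; apply: (IB).
Qed.

Lemma ideal_sum (R : rngType) (I : set R) (T : eqType) (s : seq T) (F : T -> R) :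
  is_ideal I -> (forall t, t \in s -> I (F t)) -> I (\sum_(t <- s) F t).
Proof.
move=> hI IF; rewrite big_seq; apply: (big_ind I) => //; first by case: hI.
by move=> x y; exact: ideal_add.
Qed.

(** A local unit e' for alpha x can be taken in the image of alpha, as alpha is
    onto; then alpha x = e' (alpha x) e' lies in alpha(R) I alpha(R).  Hence, for
    an automorphism of a ring with local units, strong invariance of I means
    alpha(I) = I. *)
Lemma strongly_invariantP (R : rngType) (alpha : rng_aut R) (I : set R) :
  has_local_units R -> is_ideal I ->
  strongly_invariant alpha I <-> (forall x, I (alpha x) <-> I x).
Proof.
move=> hR hI; have [_ _ IM] := hI; split=> [[sub tri] x|inv]; split.
- move=> Iax; have [e [_ /(_ x (fset11 x))[ex xe]]] := hR [fset x]%fset.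
  have [|z Iz /(bij_inj (rng_aut_bij alpha)) <-//] := tri (alpha x).
  exists [:: (alpha e, alpha x, alpha e)]; split=> [t /[!inE]/eqP->|].
    by split=> //; exists e.
  by rewrite big_seq1 /= -!rng_autM ex xe.
- by move=> Ix; apply: sub; exists x.
- by move=> y [x Ix <-]; apply/inv.
- move=> y [s [sP ->]].
  exists (rng_aut_inv alpha (\sum_(t <- s) (t.1.1 * t.1.2 * t.2)%g)).
    apply/inv; rewrite rng_aut_invK; apply: ideal_sum => // t /sP[_ It _].
    by apply: (IM _ _ _).2; apply: (IM _ _ _).1.
  by rewrite rng_aut_invK.
Qed.

Lemma invariant_zpow (R : rngType) (alpha : rng_aut R) (I : set R) :
  (forall x, I (alpha x) <-> I x) -> forall n x, I (aut_zpow alpha n x) <-> I x.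
Proof.
move=> inv n; elim/int_rect: n => [|n IH|n IH] x //.
  by rewrite -addn1 PoszD addrC aut_zpowD; apply: iff_trans (inv _) (IH x).
apply: iff_trans (IH x); rewrite -(propext (inv _)) -aut_zpowS -addn1 PoszD.
by rewrite opprD addrNK.
Qed.

Lemma aut_zpow_comm (R : rngType) (alpha : rng_aut R) (f : R -> R) :
  (forall x, alpha (f x) = f (alpha x)) ->
  forall n x, aut_zpow alpha n (f x) = f (aut_zpow alpha n x).
Proof.
move=> fC n; elim/int_rect: n => [|n IH|n IH] x //.
  by rewrite -addn1 PoszD !aut_zpowS IH fC.
apply: (bij_inj (rng_aut_bij alpha)); rewrite fC -!aut_zpowS -addn1 PoszD.
by rewrite opprD addrNK IH.
Qed.

(** * A simple crossed product forces invariant ideals to be trivial *)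

Lemma ideal_of_coefficients (R : rngType) (alpha : rng_aut R) (I : set R) :
  is_ideal I -> (forall x, I (alpha x) <-> I x) ->
  is_ideal [set a : crossed alpha | forall m, I a@_m].
Proof.
move=> hI inv; have invz := invariant_zpow _ _ _ inv.
have [I0 IB IM] := hI; split=> /=.
- by move=> m; rewrite mcoeff0.
- by move=> a b Ia Ib m; rewrite mcoeffB; apply: IB.
- move=> r a Ia; split=> m.
    rewrite mcoeff_crossed_mull; apply: ideal_sum => // n _.
    by apply: (IM _ _ _).1; apply/invz.
  rewrite mcoeff_crossed_mull; apply: ideal_sum => // n _.
  exact: (IM _ _ _).2.
Qed.

Lemma simple_crossed_invariant (R : rngType) (alpha : rng_aut R) (I : set R) :
  simple_rng (crossed alpha) -> is_ideal I ->
  (forall x, I (alpha x) <-> I x) -> I = [set 0] \/ I = setT.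
Proof.
move=> [_ simp] hI inv; have [I0 _ _] := hI.
pose K := [set a : crossed alpha | forall m, I a@_m].
have KU r : K << r *g 0 >> <-> I r.
  split=> [/(_ 0)|Ir m]; first by rewrite mcoeffUU.
  by rewrite mcoeffU; case: (0 == m).
have [K0|KT] := simp K (ideal_of_coefficients _ _ _ hI inv); [left|right].
- apply/seteqP; split=> r /= => [|->//]; rewrite -KU K0 /= => /malgP/(_ 0).
  by rewrite mcoeffUU mcoeff0.
- by apply/seteqP; split=> r //= _; rewrite -KU KT.
Qed.

(** * A simple crossed product forces the automorphism to be outer *)

(** When g is right multiplication by a multiplier u, the map
    c |-> (g c_(m + n))_m is right multiplication by z = u delta_(-n), and the set
    below is the range of 1 - z.  The hypotheses on g say that z is central, so
    this range is a two-sided ideal.  Working with coefficients avoids extending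
    multipliers of R to the crossed product. *)
Lemma crossed_shift_ideal (R : rngType) (alpha : rng_aut R) (n : nat)
    (g : {additive R -> R}) :
  (forall x, alpha (g x) = g (alpha x)) ->
  (forall r s, g (r * s)%g = (r * g s)%g) ->
  (forall r s, (g r * s)%g = (r * g (iter n alpha s))%g) ->
  is_ideal [set b : crossed alpha |
    exists c : crossed alpha, forall m, b@_m = c@_m - g c@_(m + n)].
Proof.
move=> gC gM gE; split=> /=.
- by exists 0 => m; rewrite !mcoeff0 (raddf0 g) subr0.
- move=> a b [c cP] [d dP]; exists (c - d) => m.
  by rewrite !mcoeffB cP dP (raddfB g) !opprD !opprK addrACA.
- move=> r a [c cP]; split; [exists (r * c)%g|exists (c * r)%g] => m.
    rewrite !mcoeff_crossed_mull (raddf_sum g) -sumrB.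
    apply: eq_bigr => i _; rewrite cP raddfB rmulDr rmulNr; congr (_ - _).
    by rewrite /= (aut_zpow_comm _ alpha g) // gM addrAC.
  rewrite !mcoeff_crossed_mulr (raddf_sum g) -sumrB.
  apply: eq_bigr => i _; rewrite cP rmulDl rmulNl.
  have -> : m + n%:Z - i = n%:Z + (m - i) by rewrite addrAC addrC.
  by rewrite gM gE (addrC (m - i)) (aut_zpowD _ n%:Z).
Qed.

(** If alpha is inner with periodicity n > 0, the ideal generated by 1 - z with
    z = u delta_(-n) is non-zero, since z moves degrees, and proper, since z is
    injective: the lowest and the highest term of (1 - z) c then sit at least n
    degrees apart, so (1 - z) c is never r delta_0 with r non-zero. *)
Lemma outer_of_simple_crossed (R : rngType) (alpha : rng_aut R) :
  simple_rng (crossed alpha) -> is_outer alpha.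
Proof.
move=> [[x x0] simp] n n0 [u [v [vu alphan alphau]]].
have uI r : lmult u r = 0 -> r = 0.
  by move=> e; rewrite -[r]/(lmult 1 r) -vu /= e raddf0.
(* (alpha^n r) u = u r v u = u r *)
have uE r : rmult u (iter n alpha r) = lmult u r.
  by rewrite alphan -[RHS]/(rmult 1 (lmult u r)) -vu.
have uE' r : rmult u r = lmult u (aut_zpow alpha (- n%:Z) r).
  by rewrite -uE -[iter n alpha _]/(aut_zpow alpha n _) -aut_zpowD subrr.
have rI r : rmult u r = 0 -> r = 0.
  rewrite uE' => /uI e.
  by rewrite -[r]/(aut_zpow alpha 0 r) -(subrr n%:Z) aut_zpowD e raddf0.
have uC r : alpha (rmult u r) = rmult u (alpha r).
  by rewrite !uE' alphau (aut_zpow_comm _ alpha alpha).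
have uG r s : (rmult u r * s)%g = (r * rmult u (iter n alpha s))%g.
  by rewrite uE Defs.multE.
have := crossed_shift_ideal _ alpha n (rmult u) uC (@rmultM _ u) uG.
set K := [set b | _] => hK.
have [m [_ [r0 _ _]]] := msupp_extrema _ _ x0; set r := x@_m in r0.
have nN0 : (n%:Z == 0) = false by case: (n) n0.
have [K0|KT] := simp K hK.
- (* The image of r delta_0 under 1 - z. *)
  have : K (<< r *g 0 >> - << rmult u r *g - n%:Z >>).
    exists << r *g 0 >> => k; rewrite mcoeffB !mcoeffU (raddfMn (rmult u)).
    by rewrite (eq_sym 0 (k + _)) addr_eq0 (eq_sym k).
  rewrite K0 /= => /malgP/(_ 0).
  rewrite mcoeffB mcoeffUU mcoeffU mcoeff0 oppr_eq0 nN0 mulr0n subr0 => e.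
  by rewrite e eqxx in r0.
- have : K << r *g 0 >> by rewrite KT.
  case=> c cP.
  have c0 : c != 0.
    apply: contraNneq r0 => c0; have := cP 0.
    by rewrite c0 mcoeffUU !mcoeff0 raddf0 subr0 => ->.
  have [p [q [cp cq pq]]] := msupp_extrema _ _ c0.
  (* The highest term c_q survives in c - z c, and the lowest term c_p appears
     there shifted to degree p - n; both degrees must be 0. *)
  have q0 : 0 = q.
    apply/eqP; apply: contraNT cq => q0; have := cP q.
    rewrite mcoeffU (negPf q0) mulr0n.
    have -> : c@_(q + n) = 0.
      by apply/eqP/negP=> /negP/pq; rewrite gerDl lez_nat leqNgt n0 andbF.
    by rewrite raddf0 subr0 => <-.
  have pn : 0 = p - n%:Z.
    apply/eqP; apply: contraNT cp => p0; have := cP (p - n%:Z).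
    rewrite mcoeffU (negPf p0) mulr0n subrK.
    have -> : c@_(p - n%:Z) = 0.
      by apply/eqP/negP=> /negP/pq; rewrite lerDl oppr_ge0 lez_nat leqNgt n0.
    by rewrite sub0r => /esym/eqP; rewrite oppr_eq0 => /eqP/rI->.
  have := pq p cp; rewrite lexx -q0 /=.
  by move/esym/eqP: pn; rewrite subr_eq0 => /eqP->; rewrite lez_nat leqNgt n0.
Qed.

(** * Multipliers from twisted module isomorphisms *)

(** The multiplier v is determined by r v = phi r: the twist
    phi (r s) = phi r * alpha^n s and r (v t) = (r v) t force
    v t = phi (alpha^(-n) t).  Inverting phi gives u, with r u = phi^-1 r and
    u t = alpha^n (phi^-1 t), whence u r v = alpha^n r because phi commutes with
    alpha. *)
Lemma inner_of_twisted_iso (R : rngType) (alpha : rng_aut R) (n : nat)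
    (phi : R -> R) :
  zmod_morphism phi -> bijective phi ->
  (forall r s, phi (r * s)%g = (r * phi s)%g) ->
  (forall r s, phi (r * s)%g = (phi r * iter n alpha s)%g) ->
  (forall r, phi (alpha r) = alpha (phi r)) ->
  inner_with_periodicity alpha n.
Proof.
move=> phiB [psi phiK psiK] phiMl phiMr phia.
pose al := aut_zpow alpha n; pose be := aut_zpow alpha (- n%:Z).
have alK : cancel al be.
  by move=> x; rewrite /al /be -aut_zpowD addNr.
have beK : cancel be al.
  by move=> x; rewrite /al /be -aut_zpowD subrr.
have psiB : zmod_morphism psi.
  by move=> x y; apply: (canLR phiK); rewrite phiB !psiK.
have psiMl r s : psi (r * s)%g = (r * psi s)%g.
  by apply: (canLR phiK); rewrite phiMl psiK.
have psiMr r s : psi (r * al s)%g = (psi r * s)%g.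
  by apply: (canLR phiK); rewrite phiMr psiK.
have psia r : psi (alpha r) = alpha (psi r).
  by apply: (canLR phiK); rewrite phia psiK.
have alB : zmod_morphism al := aut_zpowB alpha n.
have beB : zmod_morphism be := aut_zpowB alpha (- n%:Z).
have alM : {morph al : x y / (x * y)%g} := aut_zpowM alpha n.
have beM : {morph be : x y / (x * y)%g} := aut_zpowM alpha (- n%:Z).
have uB : zmod_morphism (al \o psi) by move=> x y; rewrite /= psiB alB.
have uM r s : al (psi (r * s)%g) = (al (psi r) * s)%g.
  by rewrite -[s in LHS]beK psiMr alM beK.
have uE r s : (r * al (psi s))%g = (psi r * s)%g.
  by apply: (can_inj psiK); rewrite psiMr psiMl.
have vB : zmod_morphism (phi \o be) by move=> x y; rewrite /= beB phiB.
have vM r s : phi (be (r * s)%g) = (phi (be r) * s)%g.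
  by rewrite beM phiMr [iter _ _ _]beK.
have vE r s : (r * phi (be s))%g = (phi r * s)%g.
  by rewrite -phiMl phiMr [iter _ _ _]beK.
exists (Multiplier uB psiB uM psiMl uE), (Multiplier vB phiB vM phiMl vE).
split=> [|r|r].
- by apply: multP => r /=; rewrite ?alK ?psiK ?phiK.
- have phial x : phi (al x) = al (phi x).
    by rewrite /al (aut_zpow_comm _ alpha phi).
  by rewrite /= phial psiK.
- by rewrite /= psia /al (aut_zpow_comm _ alpha alpha).
Qed.

(** * Ideals of the crossed product *)

Lemma local_unit_family (R : rngType) : has_local_units R ->
  forall (s : seq int) (F : int -> R), exists e : R,
    forall i, i \in s -> (e * F i)%g = F i /\ (F i * e)%g = F i.
Proof.
move=> hR s F; have [e [_ eP]] := hR [fset F i | i in s]%fset.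
by exists e => i si; apply: eP; apply/imfsetP; exists i.
Qed.

(** Ideals are stable under shifting degrees and, independently, under applying
    a power of alpha to every coefficient, even though the delta_k need not be
    elements of the crossed product. *)
Lemma ideal_twist (R : rngType) (alpha : rng_aut R) (J : set (crossed alpha)) :
  has_local_units R -> is_ideal J -> forall (k l : int) a, J a ->
  exists2 b, J b & forall m, b@_m = aut_zpow alpha k a@_(m - l).
Proof.
move=> hR [_ _ JM] k l a Ja.
have [e eP] := local_unit_family R hR (msupp a) (fun i => aut_zpow alpha k a@_i).
have [f fP] := local_unit_family R hR (msupp a) (fun i => aut_zpow alpha (- i) a@_i).
(* Multiplying by delta_k on the left applies alpha^k and shifts by k; the
   factor delta_(l - k) on the right adjusts the shift to l.  The local units e
   and f stand in for 1. *)
exists ((<< e *g k >> : crossed alpha) * a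
        * (<< f *g (l - k)%R >> : crossed alpha))%g.
  by apply: (JM _ _ _).2; apply: (JM _ _ _).1.
move=> m; rewrite mcoeff_crossed_mulU mcoeff_crossed_Umul.
have -> : m - (l - k) = k + (m - l) by rewrite opprB addrCA.
rewrite (addrC k) addrK; have [am|am] := boolP (m - l \in msupp a); last first.
  by rewrite (mcoeff_outdom am) raddf0 rmul0r rmul0l.
rewrite (eP _ am).1 addrC aut_zpowD -aut_zpowM; congr aut_zpow.
have := (fP _ am).2 => /(congr1 (aut_zpow alpha (m - l))).
by rewrite aut_zpowM -!aut_zpowD subrr.
Qed.

Definition supported (R : rngType) (N : nat) (a : {malg R[int]}) : Prop :=
  forall m, a@_m != 0 -> 0 <= m <= N%:Z.

Lemma shift_supported (R : rngType) (alpha : rng_aut R)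
    (J : set (crossed alpha)) (p q : int) (a : crossed alpha) :
  has_local_units R -> is_ideal J -> J a -> a != 0 ->
  (forall k, a@_k != 0 -> p <= k <= q) ->
  p <= q /\ exists b, [/\ J b, b != 0 & supported R `|q - p|%N b].
Proof.
move=> hR hJ Ja a0 aP; have [m [_ [am _ _]]] := msupp_extrema _ _ a0.
have pq : p <= q by have /andP[] := aP _ am; exact: le_trans.
split=> //; have [b Jb bE] := ideal_twist _ _ _ hR hJ 0 (- p) a Ja.
exists b; split=> //.
  apply: contraNneq am => b0; have := bE (m - p).
  by rewrite b0 mcoeff0 opprK subrK /= => <-.
move=> k; rewrite bE opprK => /aP.
by rewrite gez0_abs ?subr_ge0 // lerBrDr lerDr.
Qed.

(** For the least width N of the elements of J this relation turns out to be
    the graph of a bijection. *)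
Definition end_coefs (R : rngType) (alpha : rng_aut R) (J : set (crossed alpha))
    (N : nat) (r s : R) : Prop :=
  exists a : crossed alpha,
    [/\ J a, supported R N a, a@_0 = r & a@_(Posz N) = s].

(** N is the least width of a non-zero element of J.  An element of J supported
    in [0, N] with one of its end coefficients zero has smaller width, so it
    vanishes. *)
Lemma min_supported (R : rngType) (alpha : rng_aut R) (J : set (crossed alpha)) :
  has_local_units R -> is_ideal J -> J <> [set 0] -> exists N : nat,
  [/\ exists r s, [/\ end_coefs R alpha J N r s, r != 0 & s != 0],
      forall s, end_coefs R alpha J N 0 s -> s = 0
    & forall r, end_coefs R alpha J N r 0 -> r = 0].
Proof.
move=> hR hJ J0; have [Jz _ _] := hJ.
pose P N := `[< exists b, [/\ J b, b != 0 & supported R N b] >].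
have [a Ja a0] : exists2 a, J a & a != 0.
  apply: contrapT => no; apply: J0; apply/seteqP; split=> [a Ja|a ->] //=.
  by apply/eqP/negP=> /negP a0; apply: no; exists a.
have exP : exists N, P N.
  have [p [q [_ _ aP]]] := msupp_extrema _ _ a0.
  exists `|q - p|%N; apply/asboolP.
  by have [] := shift_supported _ _ _ _ _ _ hR hJ Ja a0 aP.
case: (ex_minnP exP) => N /asboolP[b [Jb b0 sb]] minN.
have short c (p q : int) : q - p < N%:Z -> J c ->
    (forall k, c@_k != 0 -> p <= k <= q) -> c = 0.
  move=> ltN Jc cP; apply/eqP/negP=> /negP c0.
  have [pq /asboolP /minN] := shift_supported _ _ _ _ _ _ hR hJ Jc c0 cP.
  by rewrite -lez_nat gez0_abs ?subr_ge0 // leNgt ltN.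
have low c : J c -> supported R N c -> c@_0 = 0 -> c = 0.
  move=> Jc sc c0; apply: (short c 1 N) => // [|k ck].
    by rewrite gtrDl oppr_lt0.
  have /andP[k0 ->] := sc _ ck; rewrite andbT -gtz0_ge1 lt_def k0 andbT.
  by apply: contraNneq ck => ->; rewrite c0.
have high c : J c -> supported R N c -> c@_(Posz N) = 0 -> c = 0.
  move=> Jc sc c0; apply: (short c 0 (N%:Z - 1)) => // [|k ck].
    by rewrite subr0 gtrDl oppr_lt0.
  have /andP[-> kN] := sc _ ck; rewrite -ltzD1 subrK lt_neqAle kN andbT.
  by apply: contraNneq ck => ->; rewrite c0.
exists N; split.
- exists b@_0, b@_(Posz N); split; first by exists b.
    by apply: contraNneq b0 => /low ->.
  by apply: contraNneq b0 => /high ->.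
- by move=> s [c [Jc sc /low -> // <-]]; rewrite mcoeff0.
- by move=> r [c [Jc sc <- /high -> //]]; rewrite mcoeff0.
Qed.

Lemma end_coefsB (R : rngType) (alpha : rng_aut R) (J : set (crossed alpha))
    (N : nat) (r s r' s' : R) : is_ideal J ->
  end_coefs R alpha J N r s -> end_coefs R alpha J N r' s' ->
  end_coefs R alpha J N (r - r') (s - s').
Proof.
move=> [_ JB _] [a [Ja sa <- <-]] [b [Jb sb <- <-]]; exists (a - b).
rewrite !mcoeffB; split=> // [|m]; first exact: JB.
rewrite mcoeffB; have [/eqP -> |/sa//] := boolP (a@_m == 0).
by rewrite sub0r oppr_eq0 => /sb.
Qed.

Lemma end_coefs_mull (R : rngType) (alpha : rng_aut R) (J : set (crossed alpha))
    (N : nat) (t r s : R) : is_ideal J ->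
  end_coefs R alpha J N r s -> end_coefs R alpha J N (t * r)%g (t * s)%g.
Proof.
move=> [_ _ JM] [a [Ja sa <- <-]].
exists ((<< t *g 0 >> : crossed alpha) * a)%g.
rewrite !mcoeff_crossed_Umul !subr0; split=> //; first exact: (JM _ _ _).1.
move=> m; rewrite mcoeff_crossed_Umul subr0 /= => am; apply: sa.
by apply: contraNneq am => ->; rewrite rmul0r.
Qed.

Lemma end_coefs_mulr (R : rngType) (alpha : rng_aut R) (J : set (crossed alpha))
    (N : nat) (t r s : R) : is_ideal J ->
  end_coefs R alpha J N r s ->
  end_coefs R alpha J N (r * t)%g (s * iter N alpha t)%g.
Proof.
move=> [_ _ JM] [a [Ja sa <- <-]].
exists (a * (<< t *g 0 >> : crossed alpha))%g.
rewrite !mcoeff_crossed_mulU !subr0; split=> //; first exact: (JM _ _ _).2.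
move=> m; rewrite mcoeff_crossed_mulU subr0 /= => am; apply: sa.
by apply: contraNneq am => ->; rewrite rmul0l.
Qed.

Lemma end_coefs_aut (R : rngType) (alpha : rng_aut R) (J : set (crossed alpha))
    (N : nat) (k : int) (r s : R) : has_local_units R -> is_ideal J ->
  end_coefs R alpha J N r s ->
  end_coefs R alpha J N (aut_zpow alpha k r) (aut_zpow alpha k s).
Proof.
move=> hR hJ [a [Ja sa <- <-]].
have [b Jb bE] := ideal_twist _ _ _ hR hJ k 0 a Ja.
exists b; rewrite !bE !subr0; split=> // m; rewrite bE subr0 => am; apply: sa.
by apply: contraNneq am => ->; rewrite raddf0.
Qed.

(** Domain and range of the relation [end_coefs] are non-zero invariant ideals,
    hence all of R; at the least width N it is thus the graph of a twisted
    isomorphism, which makes alpha inner with periodicity N unless N = 0.  If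
    N = 0, every r delta_0 lies in J, and then so does every r delta_n. *)
Lemma simple_crossed_of_outer (R : rngType) (alpha : rng_aut R) :
  has_local_units R -> is_outer alpha ->
  (forall I : set R, is_ideal I -> (forall x, I (alpha x) <-> I x) ->
    I = [set 0] \/ I = setT) ->
  simple_rng (crossed alpha).
Proof.
move=> hR out inv; split.
  apply: contrapT => triv; apply: (out 1) => //.
  (* On the zero ring every automorphism is inner, with u = v = 1. *)
  have R0 (r s : R) : r = s.
    suff t0 t : t = 0 :> R by rewrite (t0 r) (t0 s).
    apply/eqP/negP => /negP t0; apply: triv; exists << t *g 0 >>.
    by apply: contraNneq t0 => /malgP/(_ 0); rewrite mcoeffUU mcoeff0 => ->.
  by exists 1, 1; split=> *; [exact: mul1r|exact: R0|exact: R0].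
move=> J hJ; have [->|/eqP J0] := eqVneq J [set 0]; [by left|right].
have [N [[r0 [s0 [G0 r00 s00]]] fstI sndI]] := min_supported _ _ _ hR hJ J0.
pose G := end_coefs R alpha J N; have [Jz JB JM] := hJ.
have Gz : G 0 0 by exists 0; split; rewrite ?mcoeff0 // => m; rewrite mcoeff0 eqxx.
have GB r s r' s' : G r s -> G r' s' -> G (r - r') (s - s').
  exact: end_coefsB.
have GMl t r s : G r s -> G (t * r)%g (t * s)%g by exact: end_coefs_mull.
have GMr t r s : G r s -> G (r * t)%g (s * iter N alpha t)%g.
  exact: end_coefs_mulr.
have Ga k r s : G r s -> G (aut_zpow alpha k r) (aut_zpow alpha k s).
  exact: end_coefs_aut.
have aK x : aut_zpow alpha (-1) (alpha x) = x by rewrite /= rng_autK.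
have dom r : exists s, G r s.
  have [||D0|DT] := inv [set r | exists s, G r s].
  - split; first by exists 0.
      by move=> x y [s Gs] [t Gt]; exists (s - t); apply: GB.
    move=> t x [s Gs]; split; first by exists (t * s)%g; apply: GMl.
    by exists (s * iter N alpha t)%g; apply: GMr.
  - move=> x; split=> -[s Gs].
      by exists (aut_zpow alpha (-1) s); rewrite -(aK x); apply: Ga.
    by exists (alpha s); apply: (Ga 1 x s).
  - have : [set r | exists s, G r s] r0 by exists s0.
    by rewrite D0 /= => r00'; rewrite r00' eqxx in r00.
  - by have : [set r | exists s, G r s] r by rewrite DT.
have ran s : exists r, G r s.
  have [||D0|DT] := inv [set s | exists r, G r s].
  - split; first by exists 0.
      by move=> x y [r Gr] [t Gt]; exists (r - t); apply: GB.
    move=> t x [r Gr]; split; first by exists (t * r)%g; apply: GMl.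
    exists (r * aut_zpow alpha (- N%:Z) t)%g.
    have := GMr (aut_zpow alpha (- N%:Z) t) _ _ Gr.
    by rewrite -[iter _ _ _](aut_zpowD alpha N) subrr.
  - move=> x; split=> -[r Gr].
      by exists (aut_zpow alpha (-1) r); rewrite -(aK x); apply: Ga.
    by exists (alpha r); apply: (Ga 1 r x).
  - have : [set s | exists r, G r s] s0 by exists r0.
    by rewrite D0 /= => s00'; rewrite s00' eqxx in s00.
  - by have : [set s | exists r, G r s] s by rewrite DT.
have Gfun r s s' : G r s -> G r s' -> s = s'.
  move=> Gs Gs'; apply/subr0_eq/fstI; rewrite -(subrr r); exact: GB.
have Ginj r r' s : G r s -> G r' s -> r = r'.
  move=> Gr Gr'; apply/subr0_eq/sndI; rewrite -(subrr s); exact: GB.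
case: (posnP N) => [N0|/out[]]; last first.
  pose phi r := projT1 (cid (dom r)).
  have phiP r : G r (phi r) := projT2 (cid (dom r)).
  pose psi s := projT1 (cid (ran s)).
  have psiP s : G (psi s) s := projT2 (cid (ran s)).
  apply: (@inner_of_twisted_iso _ _ _ phi) => [x y||r s|r s|r].
  - by apply: Gfun (phiP _) _; apply: GB.
  - by exists psi => x; [apply: Ginj (psiP _) _|apply: Gfun (phiP _) _].
  - by apply: Gfun (phiP _) _; apply: GMl.
  - by apply: Gfun (phiP _) _; apply: GMr.
  - by apply: Gfun (phiP _) _; apply: (Ga 1 r).
(* Width 0: all homogeneous elements are in J. *)
have JU r n : J << r *g n >>.
  have [s [a [Ja sa a0 _]]] := dom r.
  have [b Jb bE] := ideal_twist _ _ _ hR hJ 0 n a Ja.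
  suff -> : << r *g n >> = b :> {malg R[int]} by [].
  apply/malgP=> m; rewrite bE mcoeffU /=; case: eqP => [<-|nm].
    by rewrite subrr a0.
  apply/esym/eqP; apply: contraPT nm => /sa; rewrite N0 -eq_le eq_sym subr_eq0.
  by move=> /eqP->.
apply/seteqP; split=> // a _; rewrite (monalgE a).
exact: (ideal_sum _ _ _ _ (fun n => << a@_n *g n >> : crossed alpha) hJ).
Qed.

(** * The simplicity criterion *)

Theorem corollary9p9 (R : rngType) (alpha : rng_aut R)
    (hR : has_local_units R) :
  simple_rng (crossed alpha) <->
  (is_outer alpha /\
   (forall I : set R, is_ideal I -> strongly_invariant alpha I ->
      I = [set 0] \/ I = setT)).
Proof.
split=> [simp|[out inv]].
  split=> [|I hI /(strongly_invariantP _ _ _ hR hI)].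
    exact: outer_of_simple_crossed.
  exact: simple_crossed_invariant simp hI.
apply: simple_crossed_of_outer => // I hI aI; apply: inv => //.
exact/strongly_invariantP.
Qed.
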